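(* Let $\Gamma_J(x,y)=(x,y,xy+yx)$. Every point of the scalar $\Gamma_J$-convex hull of a set $S\subseteq\mathbb R^2$ has a zero-covariance representation supported on at most four generating points of $S$. Four is best possible.
   Context: At level one (scalars) $\Gamma_J(x,y)=(x,y,2xy)\in\mathbb R^3$. For $S\subseteq\mathbb R^2$, the scalar $\Gamma_J$-convex hull of $S$ (generated using scalar points of $S$) is $\{(x,y)\in\mathbb R^2:(x,y,2xy)\in\operatorname{co}(\Gamma_J(S))\}$, with $\operatorname{co}$ the ordinary convex hull in $\mathbb R^3$. A zero-covariance representation of $(\bar x,\bar y)$ consists of points $(x_i,y_i)\in S$ and probabilities $t_i$ ($t_i\ge0$, $\sum_it_i=1$) such that $\bar x=\sum_it_ix_i$, $\bar y=\sum_it_iy_i$, and $\sum_it_ix_iy_i=\bar x\bar y$. ''Best possible'' means there are a set $S$ and a point of its hull with no such representation supported on three or fewer points of $S$. *)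

(* Defs.v *)
From mathcomp Require Import all_boot all_order all_algebra.
From mathcomp Require Import classical_sets reals convex.

Set Implicit Arguments.
Unset Strict Implicit.
Unset Printing Implicit Defensive.

Import Order.TTheory GRing.Theory Num.Theory.

Local Open Scope classical_set_scope.
Local Open Scope ring_scope.

Definition convex_hull (R : numDomainType) (M : lmodType R) (A : set M) : set M :=
  smallest (@convex_set R M) A.

(* R^o is R as a module over itself, so the codomain is the R-module R^3. *)
Definition Gamma_J (R : realType) (p : R * R) : R^o * R^o * R^o :=
  (p.1, p.2, p.1 * p.2 + p.2 * p.1).

Definition Gamma_J_hull (R : realType) (S : set (R * R)) : set (R * R) :=
  [set p | convex_hull (@Gamma_J R @` S) (Gamma_J p)].

Record zero_covariance_rep (R : realType) (S : set (R * R)) (p : R * R)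
    (n : nat) (q : 'I_n -> R * R) (t : 'I_n -> R) : Prop := ZeroCovarianceRep {
  zcr_points : forall i, S (q i);
  zcr_ge0 : forall i, 0 <= t i;
  zcr_sum1 : \sum_(i < n) t i = 1;
  zcr_mean1 : p.1 = \sum_(i < n) t i * (q i).1;
  zcr_mean2 : p.2 = \sum_(i < n) t i * (q i).2;
  zcr_cov : \sum_(i < n) t i * ((q i).1 * (q i).2) = p.1 * p.2
}.

Definition rep_support (R : realType) (n : nat) (q : 'I_n -> R * R)
    (t : 'I_n -> R) : seq (R * R) :=
  undup [seq q i | i <- enum 'I_n & 0 < t i].

Definition has_zero_covariance_rep (R : realType) (S : set (R * R))
    (p : R * R) (k : nat) : Prop :=
  exists (n : nat) (q : 'I_n -> R * R) (t : 'I_n -> R),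
    zero_covariance_rep S p q t /\ (size (rep_support q t) <= k)%N.

(* Main.v *)
Require Import Defs.
From mathcomp Require Import all_boot all_order all_algebra.
From mathcomp Require Import classical_sets reals.
From mathcomp Require Import boolp convex interval_inference ring lra.

(** A zero-covariance representation of [p] supported on [S] is the same thing
    as a convex combination of points of [Gamma_J @` S] equal to [Gamma_J p]:
    the first two coordinates are the mean conditions, and the third, [2xy],
    is the covariance condition. Since the curved copy of the plane lies in a
    space of dimension 3, Caratheodory's theorem reduces any such combination
    to at most [3 + 1] points ([caratheodory]).

    For sharpness take the four corners of the square [[-1, 1]^2] and its
    centre. The corners are lifted to the vertices of a nondegenerate
    tetrahedron whose barycentre is the lift of the centre. The barycentric
    coordinate of the corner [(a, b)] is the function
    [(1 + a x) (1 + b y) / 4], which only involves [1], [x], [y] and [x y]; its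
    mean under a zero-covariance representation of the centre is therefore its
    value [1 / 4] at the centre. So no corner can be dropped
    ([square_rep_full_support]). *)

Set Implicit Arguments.
Unset Strict Implicit.
Unset Printing Implicit Defensive.

Import Order.TTheory GRing.Theory Num.Theory.

Local Open Scope classical_set_scope.
Local Open Scope ring_scope.

(** The combined points are indexed through [f] by parameters in [S], so that
    representations keep track of the generating points themselves and not
    only of their images. *)
Definition convex_combination (R : numDomainType) (M : lmodType R) (T : Type)
    (f : T -> M) (S : set T) (x : M) (n : nat)
    (q : 'I_n -> T) (t : 'I_n -> R) : Prop :=
  [/\ forall i, S (q i), forall i, 0 <= t i, \sum_(i < n) t i = 1
    & x = \sum_(i < n) t i *: f (q i)].

(** The hull is a smallest convex set, so it is enough that convex
    combinations form a convex set; two of them are merged by concatenating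
    their index sets and rescaling their weights. *)
Lemma convex_hull_combination (R : numDomainType) (M : lmodType R) (T : Type)
    (f : T -> M) (S : set T) (x : M) :
  convex_hull (f @` S) x ->
  exists n (q : 'I_n -> T) (t : 'I_n -> R), convex_combination f S x q t.
Proof.
pose C : set M := [set y | exists n (q : 'I_n -> T) (t : 'I_n -> R),
  convex_combination f S y q t].
suff [cC sC] : convex_set C /\ f @` S `<=` C.
  exact: (smallest_sub cC sC).
split=> [y z l | _ [p Sp <-]]; last first.
  exists 1%N, (fun=> p), (fun=> 1).
  by split=> //; rewrite big_ord1 ?scale1r.
rewrite !inE => -[n [q [t [Sq t0 t1 ->]]]] [m [r [s [Sr s0 s1 ->]]]].
exists (n + m)%N,
  (fun i => match split i with inl j => q j | inr j => r j end),
  (fun i => match split i with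
    | inl j => l%:num * t j | inr j => (1 - l%:num) * s j end).
have splitl (j : 'I_n) : split (lshift m j) = inl j.
  exact: (unsplitK (inl j)).
have splitr (j : 'I_m) : split (rshift n j) = inr j.
  exact: (unsplitK (inr j)).
split.
- by move=> i; case: split.
- by move=> i; case: split => j; rewrite mulr_ge0 ?subr_ge0.
- rewrite big_split_ord /=.
  under eq_bigr do rewrite splitl.
  under [X in _ + X]eq_bigr do rewrite splitr.
  by rewrite -!mulr_sumr t1 s1 !mulr1 addrC subrK.
- rewrite big_split_ord /=.
  under [X in _ = X + _]eq_bigr do rewrite splitl -scalerA.
  under [X in _ = _ + X]eq_bigr do rewrite splitr -scalerA.
  by rewrite -!scaler_sumr.
Qed.

Lemma sum_pair (U V : nmodType) (n : nat) (u : 'I_n -> U) (v : 'I_n -> V) :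
  \sum_(i < n) (u i, v i) = (\sum_(i < n) u i, \sum_(i < n) v i).
Proof.
apply: (big_ind3 (fun x y z => z = (x, y))) => //.
by move=> x y _ x' y' _ -> ->.
Qed.

(** More than [dim V + 1] vectors are affinely dependent: append the
    coordinate [1] to each of them and they become linearly dependent in the
    product [V * R^o]. As the coefficients sum to zero without all vanishing,
    one of them is positive. *)
Lemma affine_dependence (R : realFieldType) (V : vectType R) (n : nat)
    (v : 'I_n -> V) :
  (dim V + 1 < n)%N ->
  exists c : 'I_n -> R, [/\ \sum_(i < n) c i = 0,
    \sum_(i < n) c i *: v i = 0 & exists i, 0 < c i].
Proof.
move=> Vn.
pose X : n.-tuple (V * R^o)%type := [tuple (v i, 1 : R^o) | i < n].
have nfX : ~ free X.
  rewrite /free size_tuple => /eqP dX.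
  have := dimvS (subvf <<X>>%VS).
  by rewrite dX dimvf leqNgt Vn.
have [c cX [j cj]] : exists2 c : 'I_n -> R,
    \sum_(i < n) c i *: X`_i = 0 & exists j, c j != 0.
  apply: contrapT => nc; apply: nfX; apply/freeP => c cX i.
  by apply: contrapT => /eqP ci; apply: nc; exists c => //; exists i.
have cX' : \sum_(i < n) (c i *: v i, c i : R^o) = 0 :> (V * R^o)%type.
  rewrite -[RHS]cX; apply: eq_bigr => i _.
  rewrite -tnth_nth tnth_mktuple; congr (_, _); exact/esym/mulr1.
move: cX'; rewrite sum_pair => -[cv c0].
exists c; split=> //.
apply: contrapT => npos.
have c_le0 i : 0 <= - c i.
  by rewrite oppr_ge0 leNgt; apply/negP => ci; apply: npos; exists i.
have /eqP : \sum_(i < n) - c i = 0 by rewrite sumrN c0 oppr0.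
rewrite psumr_eq0 // => /allP /(_ j (mem_index_enum _)).
by rewrite oppr_eq0 (negPf cj).
Qed.

(** Subtracting a multiple of an affine dependence [c] from the weights changes
    neither their sum nor the combined point. The largest multiple keeping
    the weights nonnegative is the least ratio [t i / c i] over [c i > 0]; it
    makes the weight attaining it vanish. *)
Lemma convex_combination_drop (R : realFieldType) (V : vectType R) (T : Type)
    (f : T -> V) (S : set T) (x : V) (n : nat)
    (q : 'I_n.+1 -> T) (t : 'I_n.+1 -> R) :
  (dim V < n)%N -> convex_combination f S x q t ->
  exists (r : 'I_n -> T) (s : 'I_n -> R), convex_combination f S x r s.
Proof.
move=> Vn [Sq t0 t1 xE].
have [|c [c0 cf [j cj]]] := @affine_dependence R V n.+1 (f \o q).
  by rewrite addn1.
case: (@arg_minP _ _ _ j (fun i => 0 < c i) (fun i => t i / c i) cj) => k ck kmin.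
pose a := t k / c k; pose s i := t i - a * c i.
have a0 : 0 <= a by rewrite divr_ge0 // ltW.
have sk : s k = 0 by rewrite /s /a divfK ?subrr ?gt_eqF.
have s0 i : 0 <= s i.
  rewrite subr_ge0; have [ci|ci] := ltP 0 (c i).
    by rewrite -ler_pdivlMr // kmin.
  by apply: le_trans (t0 i); rewrite mulr_ge0_le0.
exists (q \o lift k), (s \o lift k); split => /=.
- by move=> i; exact: Sq.
- by move=> i; exact: s0.
- have : \sum_i s i = 1 by rewrite sumrB -mulr_sumr c0 mulr0 subr0.
  by rewrite (bigD1_ord k) //= sk add0r.
- have : \sum_i s i *: f (q i) = x.
    under eq_bigr do rewrite scalerBl -scalerA.
    by rewrite sumrB -scaler_sumr -xE cf scaler0 subr0.
  by rewrite (bigD1_ord k) //= sk scale0r add0r.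
Qed.

Lemma caratheodory (R : realFieldType) (V : vectType R) (T : Type)
    (f : T -> V) (S : set T) (x : V) :
  convex_hull (f @` S) x ->
  exists n (q : 'I_n -> T) (t : 'I_n -> R),
    (n <= (dim V).+1)%N /\ convex_combination f S x q t.
Proof.
move=> /convex_hull_combination [n [q [t]]].
elim: n q t => [|n IHn] q t qt; first by exists 0%N, q, t.
have [nV|Vn] := leqP n (dim V); first by exists n.+1, q, t.
by have [r [s]] := convex_combination_drop Vn qt; exact: IHn.
Qed.

Lemma zero_covariance_rep_combination (R : realType) (S : set (R * R))
    (p : R * R) (n : nat) (q : 'I_n -> R * R) (t : 'I_n -> R) :
  convex_combination (@Gamma_J R) S (Gamma_J p) q t ->
  zero_covariance_rep S p q t.
Proof.
move=> [Sq t0 t1 pE].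
move: pE; rewrite !sum_pair => -[p1 p2 p3]; split=> //.
apply: (@mulIf _ 2); first by rewrite pnatr_eq0.
transitivity (p.1 * p.2 + p.2 * p.1); last by ring.
rewrite mulr_suml p3; apply: eq_bigr => i _.
transitivity (t i * ((q i).1 * (q i).2 + (q i).2 * (q i).1)) => //; ring.
Qed.

Lemma size_rep_support (R : realType) (n : nat) (q : 'I_n -> R * R)
    (t : 'I_n -> R) : (size (rep_support q t) <= n)%N.
Proof.
rewrite (leq_trans (size_undup _)) // size_map size_filter.
by rewrite (leq_trans (count_size _ _)) // size_enum_ord.
Qed.

Lemma mem_rep_support (R : realType) (n : nat) (q : 'I_n -> R * R)
    (t : 'I_n -> R) (i : 'I_n) : 0 < t i -> q i \in rep_support q t.
Proof.
by move=> ti; rewrite mem_undup map_f // mem_filter ti mem_enum.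
Qed.

Definition square_corners (R : realType) : seq (R * R) :=
  [:: (1, 1); (1, -1); (-1, 1); (-1, -1)].

Lemma uniq_square_corners (R : realType) : uniq (square_corners R).
Proof.
have N1 : (1 == -1 :> R) = false by apply/negbTE/eqP; lra.
have N1' : (-1 == 1 :> R) = false by rewrite eq_sym.
by rewrite /= !inE /= !xpair_eqE !eqxx N1 N1'.
Qed.

(** The centre of the square is the midpoint of the midpoints of its two
    diagonals, and so is its lift. *)
Lemma Gamma_J_hull_square (R : realType) :
  Gamma_J_hull [set` square_corners R] (0, 0).
Proof.
move=> A [cA sA].
have corner p : p \in square_corners R -> (Gamma_J p : convex_lmodType _) \in A.
  by move=> cp; rewrite inE; apply: sA; exists p.
have half01 : 0 <= (2^-1 : R) <= 1 by apply/andP; split; lra.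
pose h : {i01 R} := Itv01 (proj1 (andP half01)) (proj2 (andP half01)).
have D1 := cA _ _ h (corner (1, 1) _) (corner (-1, -1) _).
have D2 := cA _ _ h (corner (1, -1) _) (corner (-1, 1) _).
have := cA _ _ h (D1 _ _) (D2 _ _); rewrite !inE !eqxx ?orbT.
move=> /(_ isT isT isT isT); congr (A _).
by congr (_, _, _); rewrite /= /GRing.scale /= /unstable.onem; lra.
Qed.

(** At each point of the support other than the corner [(a, b)] the function
    [(1 + a x) (1 + b y)] vanishes, while its mean is [1]. *)
Lemma square_rep_full_support (R : realType) (n : nat)
    (q : 'I_n -> R * R) (t : 'I_n -> R) :
  zero_covariance_rep [set` square_corners R] (0, 0) q t ->
  {subset square_corners R <= rep_support q t}.
Proof.
move=> [Sq t0 t1 m1 m2 cov] [a b] abS; apply: contraT => abN.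
have mean : \sum_(i < n) t i * ((1 + a * (q i).1) * (1 + b * (q i).2)) = 1.
  transitivity (\sum_(i < n) (t i + a * (t i * (q i).1) + b * (t i * (q i).2)
      + a * b * (t i * ((q i).1 * (q i).2)))).
    by apply: eq_bigr => i _; lra.
  rewrite !big_split /= -!mulr_sumr t1 -m1 -m2 cov /=; lra.
have /eqP := mean; rewrite big1 ?(eq_sym 0) ?oner_eq0 // => i _.
have [ti|] := ltP 0 (t i); last first.
  by move=> ti; rewrite (le_anti (_ : t i <= 0 <= t i)) ?mul0r ?ti ?t0.
have : q i != (a, b) by apply: contraNneq abN => <-; exact: mem_rep_support.
have := Sq i; case: (q i) => x y /=.
move: abS; rewrite !inE.
by move=> /or4P[]/eqP[-> ->] /or4P[]/eqP[-> ->]; rewrite ?eqxx // => _; lra.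
Qed.

Theorem proposition9p5 (R : realType) :
  (forall (S : set (R * R)) (p : R * R),
     Gamma_J_hull S p -> has_zero_covariance_rep S p 4) /\
  (exists (S : set (R * R)) (p : R * R),
     Gamma_J_hull S p /\ ~ has_zero_covariance_rep S p 3).
Proof.
split=> [S p hp|].
  have [n [q [t [n4 qt]]]] :=
    @caratheodory R (R^o * R^o * R^o)%type _ (@Gamma_J R) S (Gamma_J p) hp.
  exists n, q, t; split; first exact: zero_covariance_rep_combination.
  exact: leq_trans (size_rep_support q t) n4.
exists [set` square_corners R], (0, 0); split; first exact: Gamma_J_hull_square.
move=> [n [q [t [qt]]]]; apply/negP; rewrite -ltnNge.
exact: uniq_leq_size (uniq_square_corners R) (square_rep_full_support qt).
Qed.
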